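(* Let $\mathfrak{M}=(\mathbf{M},\models,\mathcal{P}(\mathscr{L}))$ be a normal abstract model structure with induced relation $\vdash_{\mathfrak{M}}$, and let $\Gamma\subseteq\mathscr{L}$ be maximal finitely satisfiable. If $\Gamma$ is satisfiable, then $\Gamma$ is $\vdash_{\mathfrak{M}}$-closed.
   Context: An abstract model structure is a triple $(\mathbf{M},\models,\mathcal{P}(\mathscr{L}))$ with $\mathbf{M}\neq\emptyset$, $\mathscr{L}$ a set and $\models\,\subseteq\mathbf{M}\times\mathcal{P}(\mathscr{L})$. It is normal if for all $m$ and $\Gamma$: $m\models\Gamma$ iff $m\models\{\alpha\}$ for all $\alpha\in\Gamma$. $\Gamma$ is satisfiable if $m\models\Gamma$ for some $m\in\mathbf{M}$; finitely satisfiable if every finite subset is satisfiable; maximal finitely satisfiable if finitely satisfiable and no proper superset in $\mathscr{L}$ is finitely satisfiable. $\Gamma\vdash_{\mathfrak{M}}\alpha$ iff every $m$ with $m\models\Gamma$ has $m\models\{\alpha\}$. $\Gamma$ is $\vdash_{\mathfrak{M}}$-closed if for all $\beta\in\mathscr{L}$: $\Gamma\vdash_{\mathfrak{M}}\beta$ iff $\beta\in\Gamma$. *)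

(* Defs.v *)
From mathcomp Require Import all_boot.
From mathcomp Require Import classical_sets cardinality.

Set Implicit Arguments.
Unset Strict Implicit.
Unset Printing Implicit Defensive.

Local Open Scope classical_set_scope.

(* The sets M and L of a structure (M, |=, P(L)) are carrier types, so that
   P(L) is [set language]; the satisfaction relation is arbitrary. *)
Record amst := Amst {
  model : Type;
  language : Type;
  models : model -> set language -> Prop;
  model_nonempty : [set: model] !=set0
}.

Definition normal (MM : amst) : Prop :=
  forall (m : model MM) (Gamma : set (language MM)),
    models m Gamma <-> (forall alpha, Gamma alpha -> models m [set alpha]).

Definition satisfiable (MM : amst) (Gamma : set (language MM)) : Prop :=
  exists m : model MM, models m Gamma.

Definition finitely_satisfiable (MM : amst) (Gamma : set (language MM)) : Prop :=
  forall Delta : set (language MM),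
    Delta `<=` Gamma -> finite_set Delta -> satisfiable Delta.

Definition maximal_finitely_satisfiable (MM : amst)
    (Gamma : set (language MM)) : Prop :=
  finitely_satisfiable Gamma /\
  forall Delta : set (language MM),
    Gamma `<` Delta -> ~ finitely_satisfiable Delta.

Definition entails (MM : amst) (Gamma : set (language MM))
    (alpha : language MM) : Prop :=
  forall m : model MM, models m Gamma -> models m [set alpha].

Definition entails_closed (MM : amst) (Gamma : set (language MM)) : Prop :=
  forall beta : language MM, entails Gamma beta <-> Gamma beta.

(* Main.v *)
(* A model m of Gamma that also satisfies beta witnesses the satisfiability of
   every (finite) subset of Gamma together with beta, so maximality puts beta
   in Gamma. *)
Require Import Defs.
From mathcomp Require Import all_boot.
From mathcomp Require Import boolp classical_sets.

Theorem theorem3p11 (MM : amst) (hnormal : normal MM)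
    (Gamma : set (language MM))
    (hmax : maximal_finitely_satisfiable Gamma)
    (hsat : satisfiable Gamma) :
  entails_closed Gamma.
Proof.
(* Membership gives entailment because, by normality, a model of [Gamma] satisfies each of its
   singletons. *)
move=> beta; split=> [Gbeta|Gbeta m /hnormal]; last exact.
have [m mG] := hsat.
apply: contrapT => nGbeta.
apply: (hmax.2 (Gamma `|` [set beta])%classic).
  (* The extension is proper: [beta] is the element outside [Gamma]. *)
  by split=> [|sub]; [exact: subsetUl | apply/nGbeta/sub; right].
(* The same [m] serves every [Delta]: normality reduces [models m Delta] to singletons, where
   [alpha] is in [Gamma] or equals the entailed [beta]. *)
move=> Delta sDelta _; exists m; apply/hnormal => alpha /sDelta[Galpha|->].
  exact: (hnormal m Gamma).1.
exact: Gbeta.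
Qed.
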